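(* Let $G$ be a digraph rooted at $v$. Let $u\in V(G)$, let $\{u_1,\ldots,u_i\}=\mathsf{imm}_G(u)$, and let $$H=\mathsf{root}_u\Big(G\big(\mathsf{dom}_G(u_1)\to u_1;\ \ldots;\ \mathsf{dom}_G(u_i)\to u_i\big)\big[\{u,u_1,\ldots,u_i\}\big]\Big).$$ Then for every strongly connected component $H[W]$ of $H$, the polynomial $\kappa\big(\widehat{H[W]}\big)$ is prime.
   Context: Digraphs are finite directed graphs without loops; parallel edges are allowed. An arborescence of a digraph $G=(V,E)$ is a subdigraph $A$ spanning all of $V$ with a root vertex from which every vertex is reachable along a unique directed path in $A$ (a rooted directed spanning tree with edges directed away from the root). Arborescences are identified with their edge sets. Let $\mathsf{arb}(G)$ be the set of all arborescences of $G$ (over all roots). Each edge carries a label, which is a polynomial variable; distinct edges of the original digraph $G$ have distinct labels (the edge $e$ itself is used as the variable), and edges of digraphs derived from $G$ keep the label of the edge of $G$ they come from. The Kirchhoff polynomial of a digraph is $\kappa(G)=\sum_{A\in\mathsf{arb}(G)}\prod_{e\in A}e$, where $e$ stands for its label, a polynomial with rational coefficients; for a one-vertex digraph $\kappa(G)=1$. A polynomial is called prime if it has only trivial factors, i.e. whenever it equals $P\cdot Q$, one of $P,Q$ is a constant (with this convention the constant $1$ counts as prime). $G$ is rooted at $v$ if $v$ has no incoming edges and every other vertex is reachable from $v$ by a directed path. If $G$ is rooted at $v$, a vertex $u$ dominates a vertex $w$ if all directed paths from $v$ to $w$ go through $u$; $\mathsf{dom}_G(u)$ denotes the set of all vertices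 dominated by $u$ (so $u\in\mathsf{dom}_G(u)$). A vertex $y$ is the immediate dominator of $z$ if $y\neq z$, $y$ dominates $z$, and every other vertex $x\ne z$ that dominates $z$ also dominates $y$; every $z\neq v$ has exactly one immediate dominator. $\mathsf{imm}_G(y)$ is the set of vertices $z$ whose immediate dominator is $y$. The sets $\mathsf{dom}_G(z)$, $z\in\mathsf{imm}_G(y)$, partition $\mathsf{dom}_G(y)\setminus\{y\}$. $F[W]$ is the subdigraph of $F$ induced by $W$. For a digraph $F$ and $u\in V(F)$, $\mathsf{root}_u(F)$ is obtained from $F$ by removing all edges incoming to $u$. For $S\subseteq V(F)$ and $s\in S$, the contracted digraph $F(S\to s)$ is obtained from $F$ by removing all edges from $V(F)\setminus S$ to $S\setminus\{s\}$, removing all edges with both ends in $S$, and contracting all vertices of $S$ into the single vertex $s$ (edges leaving $S$ become edges leaving $s$ with the same labels, possibly parallel). For disjoint sets, $F(S_1\to s_1;\ldots;S_i\to s_i)$ is the result of performing these contractions one after another (for $i=0$ it is $F$). A strongly connected component (SCC) of a digraph is an inclusion-maximal strongly connected induced subdigraph; an SCC is initial if no edge enters it from outside. The digraph $H$ above has exactly one initial SCC, namely $\{u\}$. For an SCC $H[W]$: if it is the initial SCC, $\widehat{H[W]}=H[W]$; otherwise $\widehat{H[W]}$ is obtained from $H[W]$ by adding a new vertex $v_{\mathsf{aux}}$ and, for every edge $xy$ of $H$ with $x\notin W$, $y\in W$, an edge $v_{\mathsf{aux}}y$ with the same label as $xy$. *)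

(* Defs.v *)
From mathcomp Require Import all_boot all_order all_algebra.
From mathcomp Require Import boolp.
From mathcomp Require Import mpoly.

Set Implicit Arguments.
Unset Strict Implicit.
Unset Printing Implicit Defensive.

Import GRing.Theory.
Local Open Scope ring_scope.

(* Vertices and edges are finite subsets of ambient types [V] and [E]; the
   values of [src] and [tgt] outside [edges] are irrelevant.  Parallel edges are
   distinct elements of [E].  An operation on digraphs keeps the ambient type
   [E], so an edge of a derived digraph *is* the edge of the original digraph it
   comes from, which is also its label. *)
Record digraph (V E : finType) := Digraph {
  verts : {set V};
  edges : {set E};
  src : E -> V;
  tgt : E -> V
}.

Definition wf_digraph (V E : finType) (D : digraph V E) : Prop :=
  forall e, e \in edges D ->
    [/\ src D e \in verts D, tgt D e \in verts D & src D e != tgt D e].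

(* [dipath D x p y]: the edge sequence [p] leads from [x] to [y].  Vertices may
   repeat.  For reachability and domination this changes nothing; for the
   uniqueness clause of [arborescence] it is what forbids an edge back to an
   already visited vertex. *)
Fixpoint dipath (V E : finType) (D : digraph V E) (x : V) (p : seq E) (y : V)
    : bool :=
  if p is e :: p' then
    [&& e \in edges D, src D e == x & dipath D (tgt D e) p' y]
  else (x == y) && (x \in verts D).

Definition reachable (V E : finType) (D : digraph V E) (x y : V) : Prop :=
  exists p, dipath D x p y.

Definition spanning_sub (V E : finType) (D : digraph V E) (A : {set E})
    : digraph V E :=
  Digraph (verts D) A (src D) (tgt D).

Definition arborescence (V E : finType) (D : digraph V E) (A : {set E})
    : Prop :=
  A \subset edges D /\
  exists2 r, r \in verts D &
    forall x, x \in verts D -> exists! p, dipath (spanning_sub D A) r p x.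

Definition arb (V E : finType) (D : digraph V E) : {set {set E}} :=
  [set A | `[< arborescence D A >]].

(* One variable for each element of [E]. *)
Definition kappa (V E : finType) (D : digraph V E) : {mpoly rat[#|E|]} :=
  \sum_(A in arb D) \prod_(e in A) 'X_(enum_rank e).

Definition is_constant (n : nat) (P : {mpoly rat[n]}) : Prop :=
  exists c : rat, P = c%:MP_[n].

Definition prime_poly (n : nat) (P : {mpoly rat[n]}) : Prop :=
  forall Q R : {mpoly rat[n]}, P = Q * R -> is_constant Q \/ is_constant R.

Definition rooted (V E : finType) (D : digraph V E) (v : V) : Prop :=
  [/\ v \in verts D,
      forall e, e \in edges D -> tgt D e != v
    & forall x, x \in verts D -> reachable D v x].

(* The vertices visited by [p] from [v] are [v :: map (tgt D) p]. *)
Definition dominates (V E : finType) (D : digraph V E) (v u w : V) : Prop :=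
  [/\ u \in verts D, w \in verts D
    & forall p, dipath D v p w -> u \in v :: map (tgt D) p].

Definition dom (V E : finType) (D : digraph V E) (v u : V) : {set V} :=
  [set w | `[< dominates D v u w >]].

Definition immediate_dominator (V E : finType) (D : digraph V E) (v y z : V)
    : Prop :=
  [/\ y != z, dominates D v y z
    & forall x, x != z -> dominates D v x z -> dominates D v x y].

Definition imm (V E : finType) (D : digraph V E) (v y : V) : {set V} :=
  [set z | `[< immediate_dominator D v y z >]].

Definition induced (V E : finType) (D : digraph V E) (W : {set V})
    : digraph V E :=
  Digraph (verts D :&: W)
    [set e in edges D | (src D e \in W) && (tgt D e \in W)] (src D) (tgt D).

Definition root_at (V E : finType) (u : V) (D : digraph V E) : digraph V E :=
  Digraph (verts D) [set e in edges D | tgt D e != u] (src D) (tgt D).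

(* Among the edges that are kept, those whose target lies in [S] already end
   in [s], so only sources have to be redirected. *)
Definition contract (V E : finType) (D : digraph V E) (S : {set V}) (s : V)
    : digraph V E :=
  Digraph (s |: (verts D :\: S))
    [set e in edges D |
      ~~ ((src D e \notin S) && (tgt D e \in S :\ s)) &&
      ~~ ((src D e \in S) && (tgt D e \in S))]
    (fun e => if src D e \in S then s else src D e) (tgt D).

Definition contract_seq (V E : finType) (D : digraph V E)
    (l : seq ({set V} * V)) : digraph V E :=
  foldl (fun F c => contract F c.1 c.2) D l.

Definition strongly_connected (V E : finType) (D : digraph V E) : Prop :=
  verts D != set0 /\
  forall x y, x \in verts D -> y \in verts D -> reachable D x y.

(* [W] is the vertex set of a strongly connected component of [D]. *)
Definition scc (V E : finType) (D : digraph V E) (W : {set V}) : Prop :=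
  [/\ W \subset verts D, strongly_connected (induced D W)
    & forall W' : {set V}, W \subset W' -> W' \subset verts D ->
        strongly_connected (induced D W') -> W' = W].

Definition initial (V E : finType) (D : digraph V E) (W : {set V}) : bool :=
  [forall e in edges D, (tgt D e \in W) ==> (src D e \in W)].

(* The digraph written with a hat over [D[W]].  The vertex [x] is embedded as
   [Some x], and [None] is the auxiliary vertex. *)
Definition hat (V E : finType) (D : digraph V E) (W : {set V})
    : digraph (option V) E :=
  if initial D W then
    Digraph (Some @: verts (induced D W)) (edges (induced D W))
      (fun e => Some (src D e)) (fun e => Some (tgt D e))
  else
    Digraph (None |: (Some @: verts (induced D W)))
      (edges (induced D W) :|:
         [set e in edges D | (src D e \notin W) && (tgt D e \in W)])
      (fun e => if src D e \in W then Some (src D e) else None)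
      (fun e => Some (tgt D e)).

(* Main.v *)
Require Import Defs.
From mathcomp Require Import all_boot all_order all_algebra.
From mathcomp Require Import boolp.
From mathcomp Require Import mpoly.

Set Implicit Arguments.
Unset Strict Implicit.
Unset Printing Implicit Defensive.

Import GRing.Theory.

(* If [kappa D = Q * R] with [Q] and [R] non-constant, then, since an arborescence
   has at most one edge entering each vertex, the variables of the edges entering
   a given non-root vertex all lie in the same factor.  This colours the non-root
   vertices, both colours occur, and parent functions may be mixed freely: taking
   the parents of one arborescence on one colour class and those of another one
   on the other class gives again an arborescence.

   Call a vertex of a simple cycle [C] an entry if the root reaches it by a path
   meeting [C] only there.  Two entries [x], [y] of [C] have the same colour:
   otherwise mix an arborescence entering [C] only at [x] with one entering it
   only at [y], both agreeing elsewhere with a fixed parent function that follows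
   [C]; the mixture contains [C].  When no non-root vertex dominates another one,
   this forces every cycle to be monochromatic, and by strong connectivity there
   is only one colour, a contradiction.

   The contracted digraph [H] has no domination between distinct vertices other
   than [u], because a path of [G] projects onto a walk of [H]. *)

(** * Degree of a polynomial in a subset of the variables *)

Section PartialDegree.
Local Open Scope ring_scope.
Variables (n : nat) (K : idomainType) (S : {set 'I_n}).

Definition pdeg (m : 'X_{1..n}) : nat := (\sum_(i in S) m i)%N.

(** The new variable marks the variables in [S]: under [grading], the coefficient of ['X^d] collects
    the terms of degree [d] in [S]. *)
Definition scale_var (i : 'I_n) : {poly {mpoly K[n]}} :=
  ('X_i)%:P * 'X^(i \in S).

Definition const2 : {rmorphism K -> {poly {mpoly K[n]}}} := polyC \o @mpolyC n K.

Definition grading : {mpoly K[n]} -> {poly {mpoly K[n]}} := mmap const2 scale_var.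

Lemma gradingM p q : grading (p * q) = grading p * grading q.
Proof. by have [M _] := mmap_is_multiplicative scale_var const2; exact: M. Qed.

Lemma mmap1_scale_var m : mmap1 scale_var m = ('X_[m])%:P * 'X^(pdeg m).
Proof.
rewrite /mmap1 /scale_var.
under eq_bigr => i _ do rewrite exprMn -exprM.
rewrite big_split /=; congr (_ * _).
  by rewrite mpolyXE_id rmorph_prod /=; apply: eq_bigr => i _; rewrite rmorphXn.
rewrite prodrXr; congr ('X^_); rewrite /pdeg [RHS]big_mkcond /=.
by apply: eq_bigr => i _; case: (i \in S); rewrite ?mul1n ?mul0n.
Qed.

Lemma grading_coef p d m : (grading p)`_d@_m = p@_m *+ (pdeg m == d).
Proof.
rewrite /grading /mmap coef_sum raddf_sum /=.
rewrite (eq_bigr (fun k => p@_k * (k == m)%:R *+ (pdeg m == d))); last first.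
  move=> k _; rewrite mmap1_scale_var mulrA -polyCM coefCM coefXn.
  rewrite mulr_natr mcoeffMn mcoeffCM mcoeffX.
  case: (eqVneq k m) => [->|_]; first by rewrite (eq_sym d).
  by rewrite mulr0n mulr0 !mul0rn.
have [mp|mp] := boolP (m \in msupp p).
  rewrite (bigD1_seq m) ?msupp_uniq //= eqxx mulr1n mulr1.
  by rewrite big1 ?addr0 // => k /negbTE->; rewrite mulr0n mulr0 mul0rn.
rewrite big_seq big1 ?(memN_msupp_eq0 mp) ?mul0rn // => k kp.
case: (eqVneq k m) => [E|_]; first by rewrite -E kp in mp.
by rewrite mulr0n mulr0 mul0rn.
Qed.

(** Over an integral domain the degrees in the marking variable add, so cancellation in the product
    cannot hide the sum of the two partial degrees. *)
Lemma pdeg_factors (p q : {mpoly K[n]}) (d : nat) :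
    p * q != 0 -> {in msupp (p * q), forall m, (pdeg m <= d)%N} ->
  {in msupp p & msupp q, forall m1 m2, (pdeg m1 + pdeg m2 <= d)%N}.
Proof.
move=> pq0 dpq m1 m2 m1p m2q.
have size_gt r m : m \in msupp r -> (pdeg m < size (grading r))%N.
  rewrite mcoeff_msupp => rm; rewrite ltnNge; apply: contra rm => le.
  have := grading_coef r (pdeg m) m.
  by rewrite nth_default // eqxx mcoeff0 mulr1n => <-.
have p0 : grading p != 0.
  by rewrite -size_poly_gt0 (leq_ltn_trans _ (size_gt _ _ m1p)).
have q0 : grading q != 0.
  by rewrite -size_poly_gt0 (leq_ltn_trans _ (size_gt _ _ m2q)).
have : (size (grading (p * q)) <= d.+1)%N.
  apply/leq_sizeP => j dj; apply/mpolyP => m; rewrite grading_coef mcoeff0.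
  have [/dpq le|/memN_msupp_eq0->] := boolP (m \in msupp (p * q)).
    by rewrite ltn_eqF ?(leq_ltn_trans le).
  by rewrite mul0rn.
rewrite gradingM (size_mul p0 q0) => le.
have := leq_add (size_gt _ _ m1p) (size_gt _ _ m2q).
rewrite addSn addnS => /leq_trans; move=> /(_ d.+2).
rewrite !ltnS; apply.
by move: le; case: (_ + _)%N.
Qed.

End PartialDegree.

Lemma nonconstant_var n (P : {mpoly rat[n]}) : ~ is_constant P ->
  exists (m : 'X_{1..n}) i, m \in msupp P /\ 0 < m i.
Proof.
move=> ncP; apply: contrapT => nex; apply: ncP.
exists (mcoeff 0%MM P); apply/mpolyP => m; rewrite mcoeffC.
case: (eqVneq 0%MM m) => [<-|m0]; first by rewrite mulr1.
rewrite mulr0; apply: memN_msupp_eq0; apply/negP => mP; case/eqP: m0.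
apply/mnmP => i; rewrite mnm0E; apply/esym/eqP; rewrite -leqn0 leqNgt.
by apply/negP => mi; apply: nex; exists m, i.
Qed.

(** * Factors of [kappa] and exchange of parent edges *)

Section Exchange.
Local Open Scope ring_scope.
Variables (T E : finType) (D : digraph T E).

(** Exponent vector of the squarefree monomial of [A]. Its injectivity makes every coefficient of
    [kappa] equal to 0 or 1. *)
Definition edge_mnm (A : {set E}) : 'X_{1..#|E|} :=
  [multinom (enum_val i \in A : nat) | i < #|E|].

Lemma edge_mnmE A i : edge_mnm A i = (enum_val i \in A).
Proof. by rewrite mnmE. Qed.

Lemma edge_mnm_inj : injective edge_mnm.
Proof.
move=> A B /mnmP eqAB; apply/setP => e.
by have := eqAB (enum_rank e); rewrite !edge_mnmE enum_rankK; do 2!case: (e \in _).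
Qed.

Lemma kappaE : kappa D = \sum_(A in arb D) 'X_[edge_mnm A].
Proof.
apply: eq_bigr => A _; rewrite mpolyXE_id (reindex_onto enum_rank enum_val) /=;
  last by move=> i _; exact: enum_valK.
rewrite [RHS](eq_bigl xpredT); last by move=> e; rewrite enum_rankK eqxx.
rewrite big_mkcond; apply: eq_bigr => e _.
by rewrite edge_mnmE enum_rankK; case: (e \in A).
Qed.

Lemma kappa_coef A : (kappa D)@_(edge_mnm A) = (A \in arb D)%:R.
Proof.
rewrite kappaE raddf_sum /=; under eq_bigr do rewrite mcoeffX (inj_eq edge_mnm_inj).
have [AD|AD] := boolP (A \in arb D).
  by rewrite (bigD1 A) //= eqxx big1 ?addr0 // => B /andP[_ /negbTE->].
by rewrite big1 // => B BD; case: (eqVneq B A) => // E0; rewrite -E0 BD in AD.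
Qed.

Lemma msupp_kappa m :
  m \in msupp (kappa D) -> exists2 A, A \in arb D & m = edge_mnm A.
Proof.
rewrite kappaE => /msupp_sum_le /flattenP[s /mapP[A]].
rewrite mem_filter => /andP[AD _] ->; rewrite msuppX inE => /eqP->.
by exists A.
Qed.

Definition into (x : T) : {set 'I_#|E|} := [set i | tgt D (enum_val i) == x].

Lemma pdeg_edge_mnm A x : pdeg (into x) (edge_mnm A) = #|[set e in A | tgt D e == x]|.
Proof.
rewrite /pdeg -sum1_card big_mkcond [RHS]big_mkcond /=.
rewrite (reindex_onto enum_rank enum_val) /=; last by move=> i _; exact: enum_valK.
rewrite (eq_bigl xpredT); last by move=> e; rewrite enum_rankK eqxx.
apply: eq_bigr => e _; rewrite !inE edge_mnmE enum_rankK.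
by case: (e \in A); case: (_ == x).
Qed.

Variable U : {set T}.

(** [U] stands for the non-root vertices and [f x] for the parent edge of [x]. *)
Hypothesis arb_section : forall A, A \in arb D ->
  exists2 f : T -> E, {in U, forall x, tgt D (f x) = x} & A = f @: U.

Lemma section_into (f : T -> E) x : {in U, forall y, tgt D (f y) = y} ->
  [set e in f @: U | tgt D e == x] = if x \in U then [set f x] else set0.
Proof.
move=> fU; apply/setP => e; rewrite inE; apply/andP/idP => [[/imsetP[y yU ->]]|].
  by rewrite fU // => /eqP <-; rewrite yU inE.
case: ifP => xU; rewrite inE // => /eqP->.
by rewrite imset_f // fU.
Qed.

(** The colour [c] marks the vertices with an entering edge that occurs in [Q]. The monomial of an
    arborescence splits into a [Q]-part, on coloured heads, and an [R]-part, on the others. The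
    [Q]-part of [f] times the [R]-part of [g] arises from only one pair of monomials, so it survives
    in [kappa D]. *)
Lemma kappa_exchange Q R : kappa D != 0 -> kappa D = Q * R ->
    ~ is_constant Q -> ~ is_constant R ->
  exists c : pred T, [/\ exists2 x, x \in U & c x, exists2 x, x \in U & ~~ c x &
    forall f g : T -> E, {in U, forall x, tgt D (f x) = x} ->
      {in U, forall x, tgt D (g x) = x} -> f @: U \in arb D -> g @: U \in arb D ->
      (fun x => if c x then f x else g x) @: U \in arb D].
Proof.
move=> k0 kQR ncQ ncR.
(* An arborescence has one edge into [x] if [x] is in [U] and none otherwise; hence the edges into
   [x] cannot occur in both factors. *)
have degs x m1 m2 : m1 \in msupp Q -> m2 \in msupp R ->
    (pdeg (into x) m1 + pdeg (into x) m2 <= (x \in U))%N.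
  rewrite kQR in k0 => m1Q m2R; apply: (pdeg_factors k0) m1Q m2R => m.
  rewrite -kQR => /msupp_kappa[A /arb_section[f fU ->] ->].
  by rewrite pdeg_edge_mnm section_into //; case: ifP; rewrite ?cards1 ?cards0.
have pdeg_gt0 (m : 'X_{1..#|E|}) i : (m i > 0)%N ->
    (pdeg (into (tgt D (enum_val i))) m > 0)%N.
  by move=> mi; rewrite /pdeg (bigD1 i) ?inE ?eqxx // addn_gt0 mi.
have [mQ [iQ [mQP iQP]]] := nonconstant_var ncQ.
have [mR [iR [mRP iRP]]] := nonconstant_var ncR.
pose c x := has (fun m => (0 < pdeg (into x) m)%N) (msupp Q).
have cQ m i : m \in msupp Q -> (m i > 0)%N -> c (tgt D (enum_val i)).
  by move=> mP mi; apply/hasP; exists m => //; apply: pdeg_gt0.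
have cR m i : m \in msupp R -> (m i > 0)%N -> ~~ c (tgt D (enum_val i)).
  move=> mP /pdeg_gt0 mi; apply/hasP => -[m1 m1Q m1i].
  have := degs (tgt D (enum_val i)) _ _ m1Q mP; move: mi m1i.
  by case: (pdeg _ m) => // a _; case: (pdeg _ m1) => // b _; rewrite addSn addnS; case: (_ \in U).
exists c; split.
- exists (tgt D (enum_val iQ)); last exact: cQ iQP.
  have := degs (tgt D (enum_val iQ)) _ _ mQP mRP; case: (_ \in U) => //.
  by rewrite leqn0 addn_eq0 => /andP[/eqP z _]; have := pdeg_gt0 _ _ iQP; rewrite z.
- exists (tgt D (enum_val iR)); last exact: cR iRP.
  have := degs (tgt D (enum_val iR)) _ _ mQP mRP; case: (_ \in U) => //.
  by rewrite leqn0 addn_eq0 => /andP[_ /eqP z]; have := pdeg_gt0 _ _ iRP; rewrite z.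
move=> f g fU gU fD gD.
have split_mnm A : A \in arb D -> exists m1 m2,
    [/\ m1 \in msupp Q, m2 \in msupp R & edge_mnm A = (m1 + m2)%MM].
  move=> AD; have : edge_mnm A \in msupp (kappa D).
    by rewrite mcoeff_msupp kappa_coef AD oner_neq0.
  rewrite kQR => /msuppM_le /allpairsP[[m1 m2] /= [? ? ?]].
  by exists m1, m2.
have [f1 [f2 [f1Q f2R fE]]] := split_mnm _ fD.
have [g1 [g2 [g1Q g2R gE]]] := split_mnm _ gD.
have Q0 m i : m \in msupp Q -> ~~ c (tgt D (enum_val i)) -> m i = 0%N.
  by move=> mP; apply: contraNeq; rewrite -lt0n; apply: cQ.
have R0 m i : m \in msupp R -> c (tgt D (enum_val i)) -> m i = 0%N.
  by move=> mP; apply: contraTeq; rewrite -lt0n; apply: cR.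
set h := fun x => _.
(* [f1] consists of the edges of [f] into coloured vertices, [g2] of those of [g] into the
   others. *)
have hE : edge_mnm (h @: U) = (f1 + g2)%MM.
  apply/mnmP => i; rewrite edge_mnmE mnmDE.
  have into_h (k k' : T -> E) : {in U, forall x, tgt D (k x) = x} ->
      {in U, forall x, tgt D (k' x) = x} ->
      k (tgt D (enum_val i)) = k' (tgt D (enum_val i)) ->
      (enum_val i \in k @: U) = (enum_val i \in k' @: U).
    move=> kU k'U kk'; have memE (k1 : T -> E) : {in U, forall x, tgt D (k1 x) = x} ->
        (enum_val i \in k1 @: U) =
        (tgt D (enum_val i) \in U) && (k1 (tgt D (enum_val i)) == enum_val i).
      move=> k1U; apply/imsetP/andP => [[x xU E1]|[iU /eqP E1]].
        by rewrite {1 2}E1 k1U // xU E1.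
      by exists (tgt D (enum_val i)).
    by rewrite !memE // kk'.
  have hU : {in U, forall x, tgt D (h x) = x}.
    by move=> x xU; rewrite /h; case: ifP => _; [apply: fU | apply: gU].
  have [ci|ci] := boolP (c (tgt D (enum_val i))).
    rewrite (into_h _ f) ?/h ?ci // -edge_mnmE fE mnmDE.
    by rewrite (R0 f2 i) // (R0 g2 i).
  rewrite (into_h _ g) ?/h ?(negbTE ci) // -edge_mnmE gE mnmDE.
  by rewrite (Q0 g1 i) // (Q0 f1 i).
suff : (kappa D)@_(edge_mnm (h @: U)) != 0.
  by rewrite kappa_coef; case: (_ \in arb D); rewrite // mulr0n eqxx.
rewrite hE kQR mcoeffM.
have lt1 : (mdeg f1 < (mdeg (f1 + g2)%MM).+1)%N by rewrite mdegD ltnS leq_addr.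
have lt2 : (mdeg g2 < (mdeg (f1 + g2)%MM).+1)%N by rewrite mdegD ltnS leq_addl.
rewrite (bigD1 (BMultinom lt1, BMultinom lt2)) //= big1 ?addr0.
  by rewrite mulf_neq0 // -mcoeff_msupp.
move=> [[k1 lk1] [k2 lk2]] /= /andP[/eqP kE kne].
have [k1Q|/memN_msupp_eq0->] := boolP (k1 \in msupp Q); last by rewrite mul0r.
have [k2R|/memN_msupp_eq0->] := boolP (k2 \in msupp R); last by rewrite mulr0.
(* Exponents from [Q] vanish off the colour and those from [R] vanish on it, so the sum determines
   both summands. *)
case/eqP: kne; congr pair; apply: val_inj => /=; apply/mnmP => i;
  have := (mnmP _ _).1 kE i; rewrite !mnmDE;
  (have [ci|ci] := boolP (c (tgt D (enum_val i)));
   [rewrite (R0 g2 i) // (R0 k2 i) // !addn0 | rewrite (Q0 f1 i) // (Q0 k1 i) // !add0n]);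
  by move=> // ->.
Qed.

End Exchange.

(** * Entries of a cycle and propagation of colours *)

Section CycleEntries.
Variables (T : eqType) (r : rel T) (o : T).

Definition entry (C : seq T) (x : T) : Prop :=
  x \in C /\ exists2 p, path r o (rcons p x) & ~~ has (mem C) p.

Lemma entry_eq_mem C C' x : C =i C' -> entry C x -> entry C' x.
Proof.
move=> eqC [xC [p op pC]]; split; first by rewrite -eqC.
by exists p => //; rewrite -(eq_has eqC).
Qed.

Lemma split_last_has (a : pred T) s : has a s ->
  exists s1 x s2, [/\ s = s1 ++ x :: s2, a x & ~~ has a s2].
Proof.
elim: s => //= x s IHs; have [/IHs[s1 [y [s2 [-> ay s2a]]]] _|s2a] := boolP (has a s).
  by exists (x :: s1), y, s2.
by rewrite orbF => ax; exists [::], x, s.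
Qed.

Lemma split_first_has (a : pred T) s : has a s ->
  exists s1 x s2, [/\ s = s1 ++ x :: s2, a x & ~~ has a s1].
Proof.
by case/split_find => x s1 s2 ax s1a; exists s1, x, s2; rewrite cat_rcons.
Qed.

(* If [g] meets the arc [B], its part after the last such vertex [a] closes the
   arc from [k] to [a] into a cycle avoiding [x0], on which [k] is an entry through
   [x0]; should the path entering at [x0] meet that part, [k] is an entry of the
   original cycle instead. *)
Lemma reroute_cycle x0 A k B g :
    ucycle r (x0 :: A ++ k :: B) -> entry (x0 :: A ++ k :: B) x0 ->
    path r o (rcons g k) -> uniq g -> ~~ has (mem (x0 :: A)) g -> k \notin g ->
  entry (x0 :: A ++ k :: B) k \/
  exists h a ear B1 B2, [/\ g = h ++ a :: ear, B = B1 ++ a :: B2,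
    ucycle r (k :: B1 ++ a :: ear) & entry (k :: B1 ++ a :: ear) k].
Proof.
move=> /andP[cycC uniqC] [_ [p op pC]] og ug gA kg.
have [gB|gB] := boolP (has (mem B) g); last first.
  left; split; first by rewrite inE mem_cat mem_head !orbT.
  exists g => //; apply/hasPn => y yg.
  have := hasPn gA _ yg; have := hasPn gB _ yg; rewrite /= !inE mem_cat inE.
  by case: (y =P k) yg kg => [-> ->|_ _ _] // /negbTE-> /=; rewrite orbF.
have [h [a [ear [gE /= aB earB]]]] := split_last_has gB.
case/splitPr: B / aB => B1 B2 in cycC uniqC pC gB earB *.
have sub_ear y : y \in ear -> y \in g by rewrite gE mem_cat inE => ->; rewrite !orbT.
have earC y : y \in ear -> y \notin x0 :: A ++ k :: B1 ++ a :: B2.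
  move=> ye; have := hasPn gA _ (sub_ear _ ye); have := hasPn earB _ ye.
  rewrite /= !inE !mem_cat !inE mem_cat inE.
  case: (y =P k) (sub_ear _ ye) kg => [-> ->|_ _ _] // /negbTE-> /=.
  by rewrite orbF.
have pathk : path r a (rcons ear k).
  by move: og; rewrite gE rcons_cat /= cat_path /= => /and3P[].
have [pe|pe] := boolP (has (mem ear) p).
  left; split; first by rewrite inE mem_cat mem_head !orbT.
  case/hasP: pe => m mp me; case/splitPr: p / mp => p1 p2 in op pC.
  rewrite /= in me; case/splitPr: ear / me => e1 e2 in earC pathk gE sub_ear earB *.
  exists (p1 ++ m :: e2).
    move: op pathk; rewrite !rcons_cat /= !cat_path /=.
    by case/and3P => -> -> _ /and3P[].
  rewrite has_cat /=; move: pC; rewrite has_cat /= !negb_or => /and3P[-> -> _] /=.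
  by apply/hasPn => y ye; apply: earC; rewrite mem_cat inE ye !orbT.
right; exists h, a, ear, B1, B2.
move: uniqC; rewrite -cat_cons cat_uniq => /and3P[uA AkB ukB].
move: (ukB) => /= /andP[]; rewrite mem_cat inE !negb_or => /and3P[kB1 ka kB2].
rewrite cat_uniq /= => /and4P[uB1 hB1 aB2 uB2].
move: hB1; rewrite negb_or => /andP[aB1 _].
split=> //.
- apply/andP; split.
    move: cycC => /=; rewrite !rcons_cat !cat_path /= !rcons_cat !cat_path /=.
    by case/and5P => _ _ -> -> _ /=; rewrite pathk.
  move: (ug); rewrite gE cat_uniq => /and3P[_ _ /= /andP[ae ue]].
  rewrite /= mem_cat inE !negb_or kB1 ka cat_uniq uB1 /= ae ue negb_or.
  rewrite -[a \notin B1]/(~~ mem B1 a) aB1 /= andbT.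
  apply/andP; split; first by apply: contra kg => /sub_ear.
  by apply/hasPn => y /earC; rewrite inE !mem_cat inE mem_cat !negb_or => /and5P[].
- split; first exact: mem_head.
  exists (p ++ x0 :: A).
    move: cycC op => /=; rewrite !rcons_cat !cat_path /= !rcons_path.
    by case/and3P => -> -> _ /andP[-> ->].
  apply/hasPn => y; rewrite mem_cat => /orP[yp|yA].
    have := hasPn pC _ yp; have := hasPn pe _ yp.
    rewrite /= !(inE, mem_cat) !negb_or => ->.
    by case/and5P => _ _ -> -> /andP[-> _].
  have : y \notin k :: B1 ++ a :: B2.
    by apply: contra AkB => yk; apply/hasP; exists y.
  rewrite /= !(inE, mem_cat) !negb_or => /and4P[-> -> -> _] /=.
  by apply/negP => /sub_ear /(hasPn gA) /=; rewrite yA.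
Qed.

Variable c : pred T.
Hypothesis entry_mono : forall C, ucycle r C ->
  forall x y, entry C x -> entry C y -> c x = c y.

(** Induction on the length of [g]. If [k] is not an entry of the given cycle, it is one of the
    rerouted cycle, and so is the first vertex [k'] of [g] there; thus [k] and [k'] share their
    colour. Since [k'] lies on [B] and is reached by a proper prefix of [g], the induction
    hypothesis compares it with [x0]. *)
Lemma first_visit_color x0 A k B g :
    ucycle r (x0 :: A ++ k :: B) -> entry (x0 :: A ++ k :: B) x0 ->
    path r o (rcons g k) -> uniq g -> ~~ has (mem (x0 :: A)) g -> k \notin g ->
  c k = c x0.
Proof.
elim: {g}(size g) {-2}g (leqnn (size g)) A k B => [|n IHn] g szg A k B cycC ex0 og ug gA kg;
  have [ek|[h [a [ear [B1 [B2 [gE BE cyc5 ek]]]]]]] := reroute_cycle cycC ex0 og ug gA kg;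
  try exact: entry_mono cycC _ _ ek ex0.
  by rewrite gE size_cat addnS in szg.
pose C5 := k :: B1 ++ a :: ear.
have /split_first_has[h1 [k' [h2 [E /= k'C5 h1C5]]]] : has (mem C5) (rcons h a).
  by apply/hasP; exists a; rewrite /= ?mem_rcons ?mem_head // inE mem_cat mem_head !orbT.
have gE' : g = h1 ++ k' :: h2 ++ ear by rewrite gE -cat_rcons E -catA.
have op : path r o (rcons h1 k').
  by rewrite rcons_path; move: og; rewrite gE' rcons_cat cat_path /= => /and3P[-> ->].
have k'g : k' \in g by rewrite gE' mem_cat mem_head orbT.
have <- : c k' = c k by apply: (entry_mono cyc5) => //; split=> //; exists h1.
(* [k'] is not [k], which is off [g], and not on [ear], since [g] has no repetition. *)
have k'B : k' \in rcons B1 a.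
  move: k'C5; rewrite inE mem_cat inE mem_rcons inE.
  case: (k' =P k) => [E'|_ /=]; first by rewrite -E' k'g in kg.
  case/or3P => [->|->|k'e]; rewrite ?orbT //.
  move: ug; rewrite gE' cat_uniq /= mem_cat k'e orbT /=.
  by rewrite !andbF.
have subB : {subset rcons B1 a <= C5}.
  move=> y; rewrite mem_rcons !inE mem_cat inE => /orP[->|->]; by rewrite ?orbT.
have [B1' [B2' B1aE]] : exists B1' B2', rcons B1 a = B1' ++ k' :: B2'.
  by case/splitPr: k'B => B1' B2'; exists B1', B2'.
rewrite -cat_rcons B1aE in BE; rewrite B1aE in subB; rewrite -catA /= in BE; rewrite BE in cycC ex0.
(* The arc is extended up to [k']; [h1] avoids the added piece because that piece belongs to the
   rerouted cycle. *)
apply: (IHn h1 _ (A ++ k :: B1') k' (B2' ++ B2)); rewrite -?catA //=.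
- by rewrite -ltnS (leq_trans _ szg) // gE' size_cat /= addnS ltnS leq_addr.
- by move: ug; rewrite gE' cat_uniq => /and3P[].
- apply/hasPn => y yh; rewrite /= -cat_cons mem_cat negb_or.
  have yg : y \in g by rewrite gE' mem_cat yh.
  rewrite (hasPn gA _ yg) /= inE negb_or; have := hasPn h1C5 _ yh.
  rewrite /= {1}inE negb_or => /andP[-> _] /=; apply: contra (hasPn h1C5 _ yh) => yB.
  by apply: subB; rewrite mem_cat yB.
- by move: ug; rewrite gE' cat_uniq => /and3P[_ /= + _]; rewrite negb_or => /andP[].
Qed.

Variable U : pred T.
Hypothesis rU : forall x y, r x y -> U y.
Hypothesis o_notin : ~~ U o.
Hypothesis no_dom : forall x y, U x -> U y -> x != y ->
  exists p, [/\ path r o p, last o p = y & x \notin p].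

(* Induction on the length of the arc from [x0] to [q]: the first vertex [k] of the
   arc met by a path to [q] avoiding [x0] has the colour of [x0], and is an entry,
   closer to [q], of a cycle through [q]. *)
Lemma cycle_entry_color x0 A q B :
    ucycle r (x0 :: A ++ q :: B) -> entry (x0 :: A ++ q :: B) x0 ->
  c q = c x0.
Proof.
elim: {A}(size A).+1 {-2}A (ltnSn (size A)) x0 B => // n IHn A szA x0 B cycC ex0.
have UC x : x \in x0 :: A ++ q :: B -> U x.
  by move=> xC; apply: rU (prev_cycle _ xC); case/andP: cycC.
have Ux0 : U x0 by apply: UC (mem_head _ _).
have Uq : U q by apply: UC; rewrite inE mem_cat mem_head !orbT.
have x0q : x0 != q.
  by move: cycC => /andP[_ /= /andP[]]; rewrite mem_cat inE !negb_or => /and3P[].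
have [p [op pq px0]] := no_dom Ux0 Uq x0q.
have {p op pq px0} [p [op up pq px0]] : exists p,
    [/\ path r o p, uniq (o :: p), last o p = q & x0 \notin p].
  case/shortenP: op pq => p' op' up' sub' pq; exists p'; split=> //.
  by apply: contra px0; apply: sub'.
have {up}up : uniq p by case/andP: up.
have /split_first_has[g [k [p2 [pE /= kAq gAq]]]] : has (mem (rcons A q)) p.
  apply/hasP; exists q; last by rewrite /= mem_rcons mem_head.
  case: (p) pq => [/= oq|y p' /= <-]; last exact: mem_last.
  by move: o_notin; rewrite oq Uq.
have og : path r o (rcons g k).
  by rewrite rcons_path; move: op; rewrite pE cat_path /= => /and3P[-> ->].
move: up; rewrite pE cat_uniq /= negb_or => /and3P[ug /andP[kg _] _].
have gA : ~~ has (mem (x0 :: A)) g.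
  apply/hasPn => y yg; rewrite /= inE negb_or; apply/andP; split.
    by apply: contraNneq px0 => <-; rewrite pE mem_cat yg.
  by have := hasPn gAq _ yg; rewrite /= mem_rcons inE negb_or => /andP[].
move: kAq; rewrite mem_rcons inE; case: (k =P q) => [kq _|_ /= kA].
  by rewrite kq in og kg; apply: first_visit_color cycC ex0 og ug gA kg.
case/splitPr: A / kA => A1 A2 in szA cycC ex0 gA gAq UC.
have {}gA : ~~ has (mem (x0 :: A1)) g.
  apply/hasPn => y yg; have := hasPn gA _ yg.
  by rewrite /= -cat_cons mem_cat negb_or => /andP[].
rewrite -catA cat_cons in cycC ex0 UC.
rewrite -(first_visit_color cycC ex0 og ug gA kg).
have szA2 : size A2 < n.
  by rewrite -ltnS (leq_trans _ szA) // ltnS size_cat /= addnS ltnS leq_addl.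
have [ek|[h [a [ear [B1 [B2 [gE BE cyc5 ek]]]]]]] := reroute_cycle cycC ex0 og ug gA kg.
  (* The same cycle read from [k]: the arc to [q] is now the shorter [A2]. *)
  have rotE : rot (size (x0 :: A1)) (x0 :: A1 ++ k :: A2 ++ q :: B) =
      k :: A2 ++ q :: (B ++ x0 :: A1).
    by rewrite -cat_cons rot_size_cat /= -catA.
  apply: (IHn A2 szA2 _ (B ++ x0 :: A1)); rewrite -rotE ?rot_ucycle //.
  by apply: entry_eq_mem ek => y; rewrite mem_rot.
(* [g] avoids the arc up to [q], so [a] lies beyond [q]; the rerouted cycle therefore still passes
   through [q], with arc [A2] from [k]. *)
have aB : a \in A2 ++ q :: B by rewrite BE mem_cat mem_head orbT.
have ag : a \in g by rewrite gE mem_cat mem_head orbT.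
have := hasPn gAq _ ag; rewrite /= mem_rcons inE mem_cat inE !negb_or.
case/and4P => aq aA1 ak aA2.
move: aB; rewrite mem_cat inE (negbTE aA2) (negbTE aq) /= => aB.
case/splitPr: B / aB => Ba Bb in BE cycC ex0 UC *.
move: (cycC) => /andP[_ /= /andP[_]].
rewrite cat_uniq => /and3P[_ _ /= /andP[_]].
move=> uB; move: (uB); rewrite BE cat_uniq /= negb_or => /and3P[_ /andP[aB1 _] _].
move: uB; rewrite -cat_cons catA cat_uniq /= negb_or => /and3P[_ /andP[aBa _] _].
move/eqP: BE; rewrite -cat_cons catA eqseq_pivot2l // => /andP[/eqP B1E _].
rewrite -B1E -catA in cyc5 ek.
exact: IHn cyc5 ek.
Qed.

(** A simple return path closes the edge into a cycle. The first cycle vertex [z] on the path from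
    [o] is an entry, and every vertex of the cycle has its colour. *)
Lemma edge_color x y p s :
  r x y -> path r y s -> last y s = x -> path r o p -> last o p = x -> c x = c y.
Proof.
move=> rxy rs sx op px.
have {s rs sx} [s [rs us sx]] : exists s, [/\ path r y s, uniq (y :: s) & last y s = x].
  by case/shortenP: rs sx => s' ? ? _ ?; exists s'.
have cycC : ucycle r (y :: s) by rewrite /ucycle us andbT /= rcons_path rs sx.
have xC : x \in y :: s by rewrite -sx mem_last.
have /split_first_has[g [z [p2 [pE /= zC gC]]]] : has (mem (y :: s)) p.
  apply/hasP; exists x => //; case: (p) px => [/= ox|y' p' /= <-]; last exact: mem_last.
  case/andP: cycC => cycC _; have Ux := rU (prev_cycle cycC xC).
  by move: o_notin; rewrite ox Ux.
have ez : entry (y :: s) z.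
  split=> //; exists g => //.
  by rewrite rcons_path; move: op; rewrite pE cat_path /= => /and3P[-> ->].
suff col q : q \in y :: s -> c q = c z by rewrite !col ?mem_head.
have [n C zCE] := rot_to zC.
rewrite -(mem_rot n) zCE inE => /predU1P[-> // | qC].
have {}ez : entry (z :: C) z by apply: entry_eq_mem ez => w; rewrite -zCE mem_rot.
rewrite -(rot_ucycle n) zCE in cycC.
case/splitPr: qC cycC ez {zCE} => C1 C2 cycC ez.
exact: cycle_entry_color cycC ez.
Qed.

End CycleEntries.

(** * Walks, reachability and distance *)

Section Walks.
Variables (T E : finType) (D : digraph T E).
Hypothesis wfD : forall e, e \in edges D -> src D e \in verts D /\ tgt D e \in verts D.

Definition adj : rel T :=
  fun x y => [exists e in edges D, (src D e == x) && (tgt D e == y)].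

Lemma adjP x y :
  reflect (exists e, [/\ e \in edges D, src D e = x & tgt D e = y]) (adj x y).
Proof.
apply: (iffP existsP) => [[e /and3P[eD /eqP sx /eqP ty]]|[e [eD sx ty]]]; exists e => //.
by rewrite eD sx ty !eqxx.
Qed.

Lemma dipath_rcons x p e y :
  dipath D x (rcons p e) y = [&& dipath D x p (src D e), e \in edges D & tgt D e == y].
Proof.
elim: p x => /= [|e' p IHp] x; last by rewrite IHp -!andbA.
have [eD|] := boolP (e \in edges D); rewrite ?andbF //=.
have [sD tD] := wfD eD; case: (x =P src D e) => [->|/eqP ne].
  by rewrite eqxx sD /=; case: eqP => //= <-.
by rewrite eq_sym (negbTE ne).
Qed.

Lemma dipath_adj x p y :
  dipath D x p y -> path adj x (map (tgt D) p) /\ last x (map (tgt D) p) = y.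
Proof.
elim: p x => /= [x /andP[/eqP]|e p IHp x /and3P[eD /eqP sx /IHp[-> ->]]] //.
by split=> //; rewrite andbT; apply/adjP; exists e.
Qed.

Lemma adj_dipath x s : x \in verts D -> path adj x s ->
  exists2 p, map (tgt D) p = s & dipath D x p (last x s).
Proof.
elim: s x => [|y s IHs] x xD /=; first by exists [::]; rewrite //= eqxx.
case/andP => /adjP[e [eD sx ty]] /IHs[|p mp dp]; first by rewrite -ty; have [] := wfD eD.
by exists (e :: p); rewrite /= ?mp ?ty // eD sx eqxx.
Qed.

Lemma reachable_connect x y : reachable D x y -> connect adj x y.
Proof.
by case=> p /dipath_adj[ps pl]; apply/connectP; exists (map (tgt D) p).
Qed.

End Walks.

(** [d] is the distance from [X]. Choosing parents of smaller rank gives parent chains that must end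
    in [X]. *)
Lemma bfs_rank (T : finType) (r : rel T) (X : {set T}) : exists d : T -> nat,
  forall x y, x \in X -> y \notin X -> connect r x y ->
  exists z, [/\ r z y, d z < d y & exists2 x', x' \in X & connect r x' z].
Proof.
pose P y n := [exists x in X, [exists p : n.-tuple T, path r x p && (last x p == y)]].
have PI x (p : seq T) : x \in X -> path r x p -> P (last x p) (size p).
  move=> xX rp; apply/existsP; exists x; rewrite xX; apply/existsP.
  by exists (in_tuple p); rewrite rp eqxx.
(* The default 0 concerns only vertices unreachable from [X]. *)
pose d y := if pselect (exists n, P y n) is left ex then ex_minn ex else 0.
have dle y n : P y n -> d y <= n.
  move=> Pyn; rewrite /d; case: pselect => [ex|//].
  by case: ex_minnP => m _; apply.
have dP y n : P y n -> P y (d y).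
  move=> Pyn; rewrite /d; case: pselect => [ex|[]]; last by exists n.
  by case: ex_minnP.
exists d => x y xX yX /connectP[p rp ylast].
have := PI _ _ xX rp; rewrite -ylast => /dP /existsP[x' /andP[x'X]].
case/existsP => q /andP[]; move: (size_tuple q); case/lastP: (tval q) => [_ _|s z szs].
  by move/eqP => E'; rewrite -E' x'X in yX.
rewrite rcons_path last_rcons => /andP[rs rlast] /eqP zy; rewrite zy in rlast.
exists (last x' s); split=> //.
  by rewrite -szs size_rcons ltnS; apply: dle; apply: PI.
by exists x' => //; apply/connectP; exists s.
Qed.

(** * Arborescences as parent functions *)

Section Arborescences.
Variables (T E : finType) (D : digraph T E) (o : T).
Hypothesis oD : o \in verts D.
Hypothesis wfD : forall e, e \in edges D -> src D e \in verts D /\ tgt D e \in verts D.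
Hypothesis rootD : forall e, e \in edges D -> tgt D e != o.

Local Notation U := (verts D :\ o).

Lemma sub_wf (A : {set E}) : A \subset edges D -> forall e,
  e \in edges (spanning_sub D A) ->
  src (spanning_sub D A) e \in verts (spanning_sub D A) /\
  tgt (spanning_sub D A) e \in verts (spanning_sub D A).
Proof. by move=> /subsetP sA e /sA /wfD. Qed.

Lemma arb_root (A : {set E}) : A \in arb D -> A \subset edges D /\
  forall x, x \in verts D -> exists! p, dipath (spanning_sub D A) o p x.
Proof.
rewrite inE => /asboolP[sA [r rD uniqP]]; split=> //.
suff <- : r = o by [].
have [p [rp _]] := uniqP _ oD; case/lastP: p rp => [/= /andP[/eqP]|p e] //.
rewrite (dipath_rcons (sub_wf sA)) /=.
by case/and3P => _ /(subsetP sA)/rootD/negbTE->.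
Qed.

(** The path to a non-root vertex ends with an edge into it; two edges of [A] with the same head
    would extend to two different paths from [o]. The edge [e0] is only the default value of [f] off
    [U]. *)
Lemma arb_is_section (e0 : E) (A : {set E}) : A \in arb D ->
  exists2 f : T -> E, {in U, forall x, tgt D (f x) = x} & A = f @: U.
Proof.
case/arb_root => sA uniqP.
have inc x : x \in U -> exists2 e, e \in A & tgt D e = x.
  rewrite !inE => /andP[xo /uniqP[p [dp _]]].
  case/lastP: p dp => [/= /andP[/eqP ox]|p e]; first by rewrite ox eqxx in xo.
  rewrite (dipath_rcons (sub_wf sA)) /=.
  by case/and3P => _ eA /eqP ex; exists e.
have inj : {in A &, injective (tgt D)}.
  move=> e e' eA e'A tt'; have [eD e'D] := (subsetP sA _ eA, subsetP sA _ e'A).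
  have [[sD tD] [sD' _]] := (wfD eD, wfD e'D).
  have [p [dp _]] := uniqP _ sD; have [p' [dp' _]] := uniqP _ sD'.
  have [q [_ uq]] := uniqP _ tD.
  have dpe : dipath (spanning_sub D A) o (rcons p e) (tgt D e).
    by rewrite (dipath_rcons (sub_wf sA)) dp eA eqxx.
  have dpe' : dipath (spanning_sub D A) o (rcons p' e') (tgt D e).
    by rewrite (dipath_rcons (sub_wf sA)) dp' e'A tt' eqxx.
  by have /rcons_inj[] := etrans (esym (uq _ dpe)) (uq _ dpe').
pose f x := odflt e0 [pick e in A | tgt D e == x].
have fP x : x \in U -> f x \in A /\ tgt D (f x) = x.
  move=> /inc[e eA ex]; rewrite /f; case: pickP => [e' /andP[? /eqP]|/(_ e)] //.
  by rewrite eA ex eqxx.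
exists f => [x /fP[]//|]; apply/setP => e; apply/idP/imsetP => [eA|[x xU ->]].
  have eU : tgt D e \in U.
    by rewrite !inE; have eD := subsetP sA _ eA; have [_ ->] := wfD eD; rewrite rootD.
  by exists (tgt D e) => //; have [? tf] := fP _ eU; apply: inj.
by have [] := fP _ xU.
Qed.

(** Connectivity gives the paths. They are unique because the last edge of a path to [x] is forced
    to be [f x], and no edge enters [o]. *)
Lemma section_arb (f : T -> E) :
    {in U, forall x, f x \in edges D /\ tgt D (f x) = x} ->
    (forall x, x \in verts D -> connect (adj (spanning_sub D (f @: U))) o x) ->
  f @: U \in arb D.
Proof.
move=> fU con; have sA : f @: U \subset edges D.
  by apply/subsetP => _ /imsetP[x xU ->]; have [] := fU _ xU.
rewrite inE; apply/asboolP; split=> //; exists o => // x xD.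
have /connectP[s sp sl] := con x xD.
have [|p _ dp] := adj_dipath (sub_wf sA) _ sp; first exact: oD.
rewrite -sl in dp; exists p; split=> // p' dp'.
have fE e : e \in f @: U -> e = f (tgt D e).
  by case/imsetP => y yU ->; have [_ ->] := fU _ yU.
elim/last_ind: p x p' {xD sp sl} dp dp' => [|p e IHp] x p'; case/lastP: p' => [|p' e'] //.
- move=> /= /andP[/eqP<- _]; rewrite (dipath_rcons (sub_wf sA)) /=.
  by case/and3P => _ /(subsetP sA)/rootD/negbTE->.
- rewrite (dipath_rcons (sub_wf sA)) /=.
  case/and3P => _ /(subsetP sA)/rootD eo /eqP ex /andP[/eqP ox _].
  by rewrite ex ox eqxx in eo.
rewrite !(dipath_rcons (sub_wf sA)) /=.
case/and3P => dp /fE eE /eqP ex /and3P[dp' /fE e'E /eqP e'x].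
have ee' : e' = e by rewrite eE e'E ex e'x.
by rewrite ee' in dp' *; rewrite (IHp _ _ dp dp').
Qed.

(** Traced backwards, the path from [o] to [z] runs through parents and stays in [C], which would
    put [o] in [U]. *)
Lemma arb_acyclic (f : T -> E) (C : pred T) z :
    {in U, forall x, tgt D (f x) = x} -> f @: U \in arb D ->
    C z -> (forall x, C x -> x \in U /\ C (src D (f x))) -> False.
Proof.
move=> fU /arb_root[sA uniqP] Cz CU.
have [p [dp _]] : exists! p, dipath (spanning_sub D (f @: U)) o p z.
  by apply: uniqP; have [/setDP[]] := CU _ Cz.
suff /CU[] : C o by rewrite !inE eqxx.
elim/last_ind: p z Cz dp => [|p e IHp] z Cz; first by move=> /= /andP[/eqP->].
rewrite (dipath_rcons (sub_wf sA)) /=.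
case/and3P => dp /imsetP[x xU ex] /eqP ez; apply: IHp dp.
by have [_] := CU _ Cz; rewrite -ez ex fU.
Qed.

Hypothesis conD : forall x, x \in verts D -> connect (adj D) o x.

(** One parent function [f] follows the cycle and serves all entries: redirecting the parent of a
    single entry to an edge from outside already yields an arborescence. *)
Lemma cycle_trees C x0 : ucycle (adj D) C -> entry (adj D) o C x0 ->
  exists f : T -> E, [/\ {in U, forall x, tgt D (f x) = x},
    forall x, x \in C -> x \in U /\ src D (f x) \in C &
    forall x, entry (adj D) o C x -> exists e, tgt D e = x /\
      (fun y => if y == x then e else f y) @: U \in arb D].
Proof.
move=> /andP[cycC uniqC] [_ [p0 op0 _]].
have adjU x y : adj D x y -> y \in U.
  by case/adjP => e [eD _ <-]; rewrite !inE rootD //; have [] := wfD eD.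
have [e0 _] : exists e0 : E, true.
  by move: op0; rewrite rcons_path => /andP[_ /adjP[e0 _]]; exists e0.
have CU x : x \in C -> x \in U by move/(prev_cycle cycC); apply: adjU.
have oC : o \notin C by apply/negP => /CU; rewrite !inE eqxx.
(* [Y] is the set of vertices that [o] reaches without touching the cycle. *)
pose r1 : rel T := [rel x y | adj D x y && (y \notin C)].
pose Y := [set y | connect r1 o y].
have oY : o \in Y by rewrite inE connect0.
have YC y : y \in Y -> y \notin C.
  rewrite inE => /connectP[p]; case/lastP: p => [_ -> //|p z].
  by rewrite rcons_path last_rcons => /andP[_ /andP[_ zC]] ->.
have [d1 d1P] := bfs_rank r1 [set o].
have [d2 d2P] := bfs_rank (adj D) (Y :|: [set x in C]).
(* Three layers: the cycle predecessor on [C], a vertex of [Y] closer to [o] on [Y], and elsewhere a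
   vertex closer to the union of [Y] and [C]. *)
pose par y e := if y \in C then src D e == prev C y
  else if y \in Y then (src D e \in Y) && (d1 (src D e) < d1 y)
  else d2 (src D e) < d2 y.
pose f y := odflt e0 [pick e in edges D | (tgt D e == y) && par y e].
have fP y : y \in U -> [/\ f y \in edges D, tgt D (f y) = y & par y (f y)].
  move=> yU; suff [e [eD ey pe]] : exists e, [/\ e \in edges D, tgt D e = y & par y e].
    rewrite /f; case: pickP => [e' /and3P[? /eqP ? ?] //|/(_ e)].
    by rewrite eD ey eqxx pe.
  move: (yU) => /setD1P[yo yD]; rewrite /par; have [yC|/negbTE yC] := boolP (y \in C).
    by have /adjP[e [eD se te]] := prev_cycle cycC yC; exists e; rewrite se.
  have [yY|/negbTE yY] := boolP (y \in Y).
    have oy : connect r1 o y by move: yY; rewrite inE.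
    have yo' : y \notin [set o] by rewrite inE.
    have [z [/andP[/adjP[e [eD se te]] _] lt [o' /set1P oo' con]]] :=
      d1P o y (set11 o) yo' oy.
    by rewrite oo' in con; exists e; rewrite inE se con lt.
  have oX : o \in Y :|: [set x in C] by rewrite inE oY.
  have yX : y \notin Y :|: [set x in C] by rewrite in_setU yY inE yC.
  have [z [/adjP[e [eD se te]] lt _]] := d2P o y oX yX (conD yD).
  by exists e; rewrite se.
exists f; split=> [x /fP[]//|x xC|x [xC [p op pC]]].
  have xU := CU _ xC; have [_ _] := fP _ xU; rewrite /par xC => /eqP->.
  by rewrite mem_prev.
have lastY : last o p \in Y.
  rewrite inE; apply/connectP; exists p => //; move: op; rewrite rcons_path => /andP[+ _].
  elim: (p) (o) pC => //= y q IHq z; rewrite negb_or => /andP[yC qC] /andP[zy yq].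
  by apply/andP; split; [apply/andP | apply: IHq].
have /adjP[e [eD se te]] : adj D (last o p) x by move: op; rewrite rcons_path => /andP[].
exists e; split=> //; set g := fun y => _.
have gU : {in U, forall y, g y \in edges D /\ tgt D (g y) = y}.
  by move=> y /fP[? ? _]; rewrite /g; case: eqP => // ->.
have gf y : y != x -> g y = f y by rewrite /g => /negbTE->.
apply: section_arb => //; set R := adj _.
have step y : y \in U -> connect R o (src D (g y)) -> connect R o y.
  move=> yU con; apply: connect_trans con (connect1 _); apply/adjP; exists (g y).
  by have [_ gy] := gU _ yU; rewrite /= gy imset_f.
have RY y : y \in Y -> connect R o y.
  elim: {y}(d1 y).+1 {-2}y (ltnSn (d1 y)) => // n IHn y dy yY.
  have yC := YC _ yY; have [->|yo] := eqVneq y o; first exact: connect0.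
  have yU : y \in U.
    move: yY; rewrite inE => /connectP[q]; case/lastP: q => [_ /= E'|q z].
      by rewrite E' eqxx in yo.
    by rewrite rcons_path last_rcons => /andP[_ /andP[/adjU zU _]] ->.
  have yx : y != x by apply: contraNneq yC => ->.
  apply: step => //; rewrite gf //; have [_ _] := fP _ yU.
  rewrite /par (negbTE yC) yY => /andP[sY lt]; apply: IHn => //.
  exact: leq_trans lt _.
have Rx : connect R o x by apply: step (CU _ xC) _; rewrite /g eqxx se; apply: RY.
(* With the cycle rotated to start at [x], reachability passes from each vertex to its successor. *)
have RC y : y \in C -> connect R o y.
  have [i s rotE] := rot_to xC.
  have us : uniq (x :: s) by rewrite -rotE rot_uniq.
  have /andP[xs uniqs] := us.
  have stepC z : z \in s -> connect R o (nth x (x :: s) (index z s)) -> connect R o z.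
    move=> zs; have zx : z != x by apply: contraNneq xs => <-.
    have zC : z \in C by rewrite -(mem_rot i) rotE inE zs orbT.
    move=> con; apply: step (CU _ zC) _; rewrite gf //; have [_ _] := fP _ (CU _ zC).
    rewrite /par zC -(prev_rot i) // rotE prev_nth inE zs orbT => /eqP->.
    exact: con.
  rewrite -(mem_rot i) rotE inE => /predU1P[-> //|/(nthP x)[j js <-]] {y}.
  elim: j js => [|j IHj] js; apply: stepC (mem_nth x js) _; rewrite index_uniq //=.
  exact: IHj (ltnW js).
move=> y; elim: {y}(d2 y).+1 {-2}y (ltnSn (d2 y)) => // n IHn y dy yD.
have [/RY//|yY] := boolP (y \in Y); have [/RC//|yC] := boolP (y \in C).
have yU : y \in U by rewrite !inE yD andbT; apply: contraNneq yY => ->.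
have yx : y != x by apply: contraNneq yC => ->.
apply: step => //; rewrite gf //; have [fD _] := fP _ yU.
rewrite /par (negbTE yC) (negbTE yY) => lt; apply: IHn; first exact: leq_trans lt _.
by have [] := wfD fD.
Qed.

End Arborescences.

(** * Primality criterion for rooted digraphs *)

Lemma kappa_prime (T E : finType) (D : digraph T E) (o : T) :
    o \in verts D ->
    (forall e, e \in edges D -> src D e \in verts D /\ tgt D e \in verts D) ->
    (forall e, e \in edges D -> tgt D e != o) ->
    (forall x, x \in verts D -> connect (adj D) o x) ->
    (forall x y, x \in verts D :\ o -> y \in verts D :\ o -> connect (adj D) x y) ->
    (forall x y, x \in verts D :\ o -> y \in verts D :\ o -> x != y ->
       exists p, [/\ path (adj D) o p, last o p = y & x \notin p]) ->
  prime_poly (kappa D).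
Proof.
move=> oD wfD rootD conD sconD no_dom Q R kQR.
have [cQ|ncQ] := pselect (is_constant Q); first by left.
have [cR|ncR] := pselect (is_constant R); first by right.
exfalso.
have const0 : is_constant (0 : {mpoly rat[#|E|]}) by exists 0%R; rewrite mpolyC0.
have k0 : kappa D != 0%R.
  by rewrite kQR mulf_neq0 //; apply/eqP => E0; [apply: ncQ | apply: ncR]; rewrite E0.
(* A variable of [Q] supplies an edge, used as the default value in [arb_is_section]. *)
have [m [i _]] := nonconstant_var ncQ.
have arb_sec := arb_is_section oD wfD rootD (enum_val i).
have [c [[x xU cx] [y yU cy] mix]] := kappa_exchange arb_sec k0 kQR ncQ ncR.
have adjU z w : adj D z w -> w \in verts D :\ o.
  by case/adjP => e [eD _ <-]; rewrite !inE rootD //; have [] := wfD _ eD.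
have entry_mono C : ucycle (adj D) C ->
    forall z w, entry (adj D) o C z -> entry (adj D) o C w -> c z = c w.
  move=> cycC.
  suff half z w : entry (adj D) o C z -> entry (adj D) o C w -> c z -> c w.
    by move=> z w ez ew; apply/idP/idP; apply: half.
  move=> ez ew cz; apply: contraT => cw.
  have [f [fU fC trees]] := cycle_trees oD wfD rootD conD cycC ez.
  have [e1 [te1 tree1]] := trees _ ez; have [e2 [te2 tree2]] := trees _ ew.
  (* The tree entering at [w] is used on coloured vertices and [w] is not coloured; the tree
     entering at [z] is used on the others and [z] is coloured. Both redirections are lost, and the
     mixture is [f] itself, which contains the cycle. *)
  have := mix _ _ _ _ tree2 tree1; rewrite (_ : _ @: _ = f @: (verts D :\ o)).
    move=> fD; case: (arb_acyclic oD wfD rootD (C := mem C) (z := z) fU (fD _ _)) => //=.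
    - by move=> a aU; case: eqP => [->|_]; last exact: fU.
    - by move=> a aU; case: eqP => [->|_]; last exact: fU.
    - by case: ez.
  apply: eq_imset => a; case: ifPn => ca.
    by case: eqP => // E1; rewrite -E1 ca in cw.
  by case: eqP => // E1; rewrite E1 cz in ca.
have edge z w : z \in verts D :\ o -> adj D z w -> c z = c w.
  move=> zU zw; have wU := adjU _ _ zw.
  have /connectP[s ws sz] := sconD _ _ wU zU.
  have zD : z \in verts D by case/setD1P: zU.
  have /connectP[p op pz] := conD _ zD.
  apply: (edge_color entry_mono (U := mem (verts D :\ o))) zw ws _ op _ => //.
  by rewrite /= !inE eqxx.
suff cxy : c x = c y by rewrite -cxy cx in cy.
have /connectP[p xp ->] := sconD _ _ xU yU.
elim: p x xU {cx} xp => //= z p IHp x xU /andP[xz /IHp <-]; first exact: edge.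
exact: adjU xz.
Qed.

(** * The dominance order *)

Section Dominators.
Variables (V E : finType) (G : digraph V E) (v : V).
Hypothesis wfG : wf_digraph G.
Hypothesis rootG : rooted G v.

Local Notation r := (adj G).

Lemma wf_ends e : e \in edges G -> src G e \in verts G /\ tgt G e \in verts G.
Proof. by case/wfG. Qed.

Lemma adj_verts x y : r x y -> x \in verts G /\ y \in verts G.
Proof. by case/adjP => e [/wf_ends[sG tG] <- <-]. Qed.

Lemma path_from_root x : x \in verts G -> exists2 s, path r v s & last v s = x.
Proof.
case: rootG => _ _ reach /reach[p /dipath_adj[ps pl]].
by exists (map (tgt G) p).
Qed.

Lemma dominatesP u w : dominates G v u w <->
  [/\ u \in verts G, w \in verts G &
      forall s, path r v s -> last v s = w -> u \in v :: s].
Proof.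
have [vG _ _] := rootG; split=> -[uG wG doms]; split=> //.
  move=> s /(adj_dipath wf_ends vG)[p <- dp] lw; apply: doms.
  by rewrite -lw.
by move=> p /dipath_adj[ps pl]; apply: doms.
Qed.

Lemma dominates_refl u : u \in verts G -> dominates G v u u.
Proof. by move=> uG; apply/dominatesP; split=> // s _ <-; apply: mem_last. Qed.

Lemma not_dominates u w : u \in verts G -> w \in verts G -> ~ dominates G v u w ->
  exists s, [/\ path r v s, last v s = w & u \notin v :: s].
Proof.
move=> uG wG ndom; apply: contrapT => nex; apply: ndom; apply/dominatesP.
split=> // s vs sw; apply: contraT => us; case: nex; by exists s.
Qed.

Lemma path_suffix (T : Type) (e : rel T) x s s1 y s2 :
  path e x s -> x :: s = s1 ++ y :: s2 -> path e y s2 /\ last y s2 = last x s.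
Proof.
by move=> + xsE; case: s1 xsE => [[-> ->]|_ s1 [_ ->]];
   rewrite // cat_path last_cat /= => /and3P[].
Qed.

Lemma path_split (T : eqType) (e : rel T) x s y : path e x s -> y \in x :: s ->
  exists s1 s2, [/\ s = s1 ++ s2, path e x s1, last x s1 = y & path e y s2].
Proof.
move=> es ys; case/splitPl: ys es => s1 s2 ys1; rewrite cat_path ys1 => /andP[es1 es2].
by exists s1, s2.
Qed.

Lemma dominates_trans x y z : dominates G v x y -> dominates G v y z -> dominates G v x z.
Proof.
move=> /dominatesP[xG _ domxy] /dominatesP[_ zG domyz]; apply/dominatesP; split=> // s vs sz.
have [s1 [s2 [-> vs1 ys1 _]]] := path_split vs (domyz s vs sz).
by rewrite -cat_cons mem_cat domxy.
Qed.

(** Infinite descent: a path from [v] to one of two distinct such vertices would have a strictly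
    shorter prefix ending at the other. *)
Lemma dominates_antisym x y : dominates G v x y -> dominates G v y x -> x = y.
Proof.
move=> /dominatesP[xG yG domxy] /dominatesP[_ _ domyx]; apply: contrapT => /eqP xy.
suff nopath n s : size s < n -> path r v s -> last v s != x /\ last v s != y.
  have [s vs sx] := path_from_root xG.
  by have [] := nopath _ s (ltnSn _) vs; rewrite sx eqxx.
elim: n s => // n IHn s szs vs; suff noend a b : a != b ->
    (path r v s -> last v s = a -> b \in v :: s) ->
    (forall t, size t < n -> path r v t -> last v t != b) -> last v s != a.
  split; [apply: (noend x y) | apply: (noend y x)]; rewrite ?[y == x]eq_sym //.
  - by move=> *; apply: domyx.
  - by move=> t tn vt; have [] := IHn t tn vt.
  - by move=> *; apply: domxy.
  - by move=> t tn vt; have [] := IHn t tn vt.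
move=> ab domba noend; apply/eqP => sa.
have [s1 [s2 [sE vs1 s1b _]]] := path_split vs (domba vs sa).
have : size s1 < n; last by move/noend/(_ vs1); rewrite s1b eqxx.
rewrite -ltnS (leq_trans _ szs) // ltnS sE size_cat -addn1 leq_add2l lt0n size_eq0.
apply: contraNneq ab => s20; move: sa; rewrite sE s20 cats0 s1b => ->.
by rewrite eqxx.
Qed.

(** On a path to [z], take the last vertex among [x] and [y]. Were they incomparable, that vertex
    could be reached avoiding the other one, and the remainder of the path would complete a detour
    around a dominator of [z]. *)
Lemma dominates_total x y z : dominates G v x z -> dominates G v y z ->
  dominates G v x y \/ dominates G v y x.
Proof.
move=> /dominatesP[xG zG domxz] /dominatesP[yG _ domyz]; apply: contrapT.
move=> /not_orP[/(not_dominates xG yG)[p [vp py xp]] /(not_dominates yG xG)[q [vq qx yq]]].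
have [s vs sz] := path_from_root zG.
have : has (pred2 x y) (v :: s).
  by apply/hasP; exists x; rewrite ?domxz //= eqxx.
case/split_last_has => s1 [a [s2 [sE /= axy s2xy]]].
have [as2 s2z] := path_suffix vs sE; rewrite sz in s2z.
have splice t b b' : path r v t -> last v t = b -> b = a -> b' \notin v :: t ->
    b' \notin s2 -> (forall s, path r v s -> last v s = z -> b' \in v :: s) -> False.
  move=> vt tb ba b't b's2 domb'.
  have := domb' (t ++ s2); rewrite cat_path last_cat tb ba vt as2 s2z => /(_ isT erefl).
  by rewrite -cat_cons mem_cat (negbTE b't) (negbTE b's2).
have xs2 : x \notin s2 by apply: contra s2xy => ?; apply/hasP; exists x; rewrite //= eqxx.
have ys2 : y \notin s2.
  by apply: contra s2xy => ?; apply/hasP; exists y; rewrite //= eqxx orbT.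
case/orP: axy => /eqP ab.
  exact: (splice q x y).
exact: (splice p y x).
Qed.

Lemma dominates_edge x y z : r x y -> dominates G v z y -> z != y -> dominates G v z x.
Proof.
move=> xy /dominatesP[zG yG domzy] zy; have [xG _] := adj_verts xy.
apply/dominatesP; split=> // s vs sx.
have := domzy (rcons s y); rewrite rcons_path last_rcons vs sx xy => /(_ isT erefl).
by rewrite -rcons_cons mem_rcons inE (negbTE zy).
Qed.

Variable u : V.
Hypothesis uG : u \in verts G.

Lemma immP z : reflect (immediate_dominator G v u z) (z \in imm G v u).
Proof. by rewrite inE; apply: asboolP. Qed.

Lemma domP x y : reflect (dominates G v x y) (y \in dom G v x).
Proof. by rewrite inE; apply: asboolP. Qed.

Lemma imm_dominates z : z \in imm G v u -> u != z /\ dominates G v u z.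
Proof. by case/immP. Qed.

(** The dominators of [x] form a chain; if one of [z], [z'] strictly dominated the other, it would
    also dominate [u], against antisymmetry. *)
Lemma imm_dom_inj x z z' : z \in imm G v u -> z' \in imm G v u ->
  x \in dom G v z -> x \in dom G v z' -> z = z'.
Proof.
move=> zI z'I /domP zx /domP z'x; apply: contrapT => /eqP zz'.
have [uz uzd] := imm_dominates zI; have [uz' uz'd] := imm_dominates z'I.
have [zz'd|z'zd] := dominates_total zx z'x.
  have /immP[_ _ /(_ z zz' zz'd) zu] := z'I.
  by rewrite (dominates_antisym uzd zu) eqxx in uz.
have /immP[_ _ /(_ z')] := zI; rewrite eq_sym => /(_ zz' z'zd) z'u.
by rewrite (dominates_antisym uz'd z'u) eqxx in uz'.
Qed.

Lemma imm_notin z : z \in imm G v u -> u \notin dom G v z.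
Proof.
case/imm_dominates => uz uzd; apply/domP => zu.
by rewrite (dominates_antisym uzd zu) eqxx in uz.
Qed.

Lemma imm_self z : z \in imm G v u -> z \in dom G v z.
Proof.
case/imm_dominates => _ /dominatesP[_ zG _].
by apply/domP; apply: dominates_refl.
Qed.

(** Among the vertices other than [u] between [u] and [x], one with the largest dominated set is
    highest in the chain, hence immediately below [u]. *)
Lemma imm_cover x : dominates G v u x -> u != x ->
  exists2 z, z \in imm G v u & x \in dom G v z.
Proof.
move=> ux nux; have /dominatesP[_ xG _] := ux.
pose P z := [&& z != u, z \in dom G v u & x \in dom G v z].
have Px : P x by rewrite /P eq_sym nux /=; apply/andP; split; apply/domP => //;
  apply: dominates_refl.
case: (arg_maxnP (fun z => #|dom G v z|) Px) => z /and3P[zu /domP uz /domP zx] maxz.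
exists z; last exact/domP; apply/immP; split=> //; first by rewrite eq_sym.
move=> y yz yzd; have yx := dominates_trans yzd zx.
have [//|uy] := dominates_total yx ux.
have [->|yu] := eqVneq y u; first exact: dominates_refl.
have Py : P y by rewrite /P yu /=; apply/andP; split; exact/domP.
suff : dom G v z \proper dom G v y by move/proper_card; rewrite ltnNge (maxz y Py : _ <= _).
apply/properP; split.
  by apply/subsetP => w /domP zw; apply/domP; apply: dominates_trans zw.
have /dominatesP[yG _ _] := yzd.
exists y; first by apply/domP; apply: dominates_refl.
by apply/domP => zy; rewrite (dominates_antisym yzd zy) eqxx in yz.
Qed.

End Dominators.

(** * Edges under successive contractions *)

Lemma contract_seq_tgt (V E : finType) (G : digraph V E) l :
  tgt (contract_seq G l) = tgt G.
Proof. by elim: l G => //= c l IHl G; rewrite /contract_seq /= -/(contract_seq _ l) IHl. Qed.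

(** Disjointness keeps the contractions independent: a source redirected to [z] lies in no later
    set, so each source moves at most once. *)
Lemma contract_seq_edge (V E : finType) (S : V -> {set V}) (zs : seq V)
    (G : digraph V E) (e : E) :
    uniq zs -> {in zs, forall z, z \in S z} ->
    {in zs &, forall z z' x, x \in S z -> x \in S z' -> z = z'} ->
    e \in edges G ->
    {in zs, forall z, tgt G e \in S z -> tgt G e = z /\ src G e \notin S z} ->
  let G' := contract_seq G [seq (S z, z) | z <- zs] in
  [/\ e \in edges G', {in zs, forall z, src G e \in S z -> src G' e = z} &
      {in zs, forall z, src G e \notin S z} -> src G' e = src G e].
Proof.
elim: zs G => //= z zs IHzs G /andP[zzs uzs] selfS disjS eG tgtS.
have zS : z \in S z by apply: selfS; apply: mem_head.
have in_cons z' : z' \in zs -> z' \in z :: zs by rewrite inE => ->; rewrite orbT.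
have zS' z' : z' \in zs -> z \notin S z'.
  move=> z'zs; apply: contra zzs => zz'.
  by rewrite (disjS z z' (mem_head _ _) (in_cons _ z'zs) z).
have srcS z' : z' \in zs -> src G e \in S z -> src G e \notin S z'.
  move=> z'zs sz; apply: contra zzs => sz'.
  by rewrite (disjS z z' (mem_head _ _) (in_cons _ z'zs) (src G e)).
set G1 := contract G (S z) z; rewrite /contract_seq /= -/G1 -/(contract_seq G1 _).
have eG1 : e \in edges G1.
  rewrite inE eG !inE; case: (boolP (tgt G e \in S z)) => [/tgtS[|-> /negbTE->]|_].
  - exact: mem_head.
  - by rewrite eqxx.
  by rewrite !andbF.
have src1 : src G1 e = if src G e \in S z then z else src G e by [].
have [] := IHzs G1 uzs _ _ eG1.
- by move=> z' /in_cons; apply: selfS.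
- by move=> z1 z2 /in_cons ? /in_cons ?; apply: disjS.
- move=> z' z'zs /(tgtS _ (in_cons _ z'zs))[tz' sz']; split=> //.
  by rewrite src1; case: ifP => // _; apply: zS'.
rewrite src1 => eG' srcE srcN; split=> // [z'|nS].
  rewrite inE => /predU1P[-> sz|z'zs sz'].
    by rewrite srcN sz // => z' z'zs; apply: zS'.
  apply: srcE => //; case: ifPn => // sz.
  by have := srcS _ z'zs sz; rewrite sz'.
have nz : src G e \notin S z by apply: nS; apply: mem_head.
by rewrite srcN (negbTE nz) // => z' /in_cons; apply: nS.
Qed.

(** * Projecting paths of [G] onto the contracted digraph *)

Section ContractedGraph.
Variables (V E : finType) (G : digraph V E) (v u : V) (us : seq V).
Hypothesis wfG : wf_digraph G.
Hypothesis rootG : rooted G v.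
Hypothesis uG : u \in verts G.
Hypothesis uniq_us : uniq us.
Hypothesis usE : us =i imm G v u.

Definition dom_quotient : digraph V E :=
  root_at u (induced (contract_seq G [seq (dom G v z, z) | z <- us])
                     [set x in u :: us]).
Local Notation H := dom_quotient.

(** The contraction map on vertices dominated by [u]; the default value makes it fix [u]. *)
Definition proj (x : V) : V := odflt x [pick z in us | x \in dom G v z].

Lemma us_dom_inj x z z' : z \in us -> z' \in us ->
  x \in dom G v z -> x \in dom G v z' -> z = z'.
Proof. by rewrite !usE; apply: imm_dom_inj. Qed.

Lemma projE z x : z \in us -> x \in dom G v z -> proj x = z.
Proof.
move=> zus zx; rewrite /proj; case: pickP => [z' /andP[z'us z'x]|/(_ z)] /=.
  exact: us_dom_inj zx.
by rewrite zus zx.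
Qed.

Lemma proj_u : proj u = u.
Proof.
rewrite /proj; case: pickP => //= z /andP[]; rewrite usE => /(imm_notin wfG rootG).
by move=> /negbTE->.
Qed.

Lemma proj_imm z : z \in us -> proj z = z.
Proof. by move=> zus; apply: projE => //; apply: (imm_self wfG rootG (u := u)); rewrite -usE. Qed.

Lemma projP x : dominates G v u x -> u != x -> proj x \in us /\ x \in dom G v (proj x).
Proof.
move=> ux /(imm_cover wfG rootG uG ux)[z]; rewrite -usE => zus zx.
by rewrite (projE zus zx).
Qed.

Lemma u_notin_us : u \notin us.
Proof. by rewrite usE; apply/negP => /imm_dominates[]; rewrite eqxx. Qed.

(** An edge can enter the set dominated by [proj y] from outside only at [proj y] itself, by
    [dominates_edge]; such edges survive the contractions. *)
Lemma quotient_edge x y : adj G x y -> dominates G v u x ->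
  dominates G v u y -> u != y -> proj x != proj y -> adj H (proj x) (proj y).
Proof.
move=> xy ux uy nuy pxy; have [pyus ydom] := projP uy nuy.
have projx z : z \in us -> x \in dom G v z -> z != proj y.
  by move=> zus xz; rewrite -(projE zus xz).
have py : proj y = y.
  apply: contraNeq pxy => py; rewrite (projE pyus) //; apply/domP.
  exact: (dominates_edge wfG rootG xy (elimT (domP _ _ _ _) ydom) py).
have [e [eG sx ty]] := adjP _ _ _ xy.
have [|||| eC srcE srcN] := @contract_seq_edge _ _ (dom G v) us G e uniq_us.
- by move=> z; rewrite usE; apply: (imm_self wfG rootG (u := u)).
- by move=> z z' zus z'us w; apply: us_dom_inj.
- by [].
- move=> z zus; rewrite sx ty => yz; have pyz := projE zus yz; rewrite -pyz py.
  split=> //; apply/negP => xy'; have := projx _ zus.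
  by rewrite -pyz {1}py => /(_ xy'); rewrite eqxx.
have srcH : src H e = proj x.
  rewrite /= -[RHS]/(proj x); have [ux'|nux] := eqVneq u x.
    rewrite -ux' proj_u srcN sx // => z zus; rewrite -ux'.
    by apply: (imm_notin wfG rootG); rewrite -usE.
  by have [pxus xdom] := projP ux nux; apply: srcE; rewrite ?sx.
have tgtH : tgt H e = proj y by rewrite /= contract_seq_tgt py.
apply/adjP; exists e; split=> //; rewrite /= !inE /=.
have -> : tgt (contract_seq G [seq (dom G v z, z) | z <- us]) e = proj y by [].
have -> : src (contract_seq G [seq (dom G v z, z) | z <- us]) e = proj x by [].
rewrite eC pyus orbT /= andbT; apply/andP; split.
  have [<-|nux] := eqVneq u x; first by rewrite proj_u eqxx.
  by have [-> _] := projP ux nux; rewrite orbT.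
by rewrite py eq_sym.
Qed.

Lemma quotient_path x s : path (adj G) x s -> dominates G v u x ->
    (forall y, y \in s -> dominates G v u y /\ u != y) ->
  exists t, [/\ path (adj H) (proj x) t, last (proj x) t = proj (last x s) &
                {subset t <= map proj s}].
Proof.
elim: s x => [|y s IHs] x /=; first by exists [::].
case/andP => xy ys ux us_dom; have [uy nuy] := us_dom _ (mem_head _ _).
have [|t [yt tlast tsub]] := IHs y ys uy.
  by move=> w ws; apply: us_dom; rewrite inE ws orbT.
have [pxy|pxy] := eqVneq (proj x) (proj y).
  exists t; rewrite pxy; split=> // w /tsub.
  by rewrite inE => ->; rewrite orbT.
exists (proj y :: t); rewrite /= quotient_edge // yt tlast; split=> // w.
by rewrite !inE => /predU1P[->|/tsub->]; rewrite ?eqxx ?orbT.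
Qed.

(** Only the part of [s] after its last visit to [u] is projected, since it stays among the vertices
    dominated by [u]. *)
Lemma quotient_path_to z s : z \in us -> path (adj G) v s -> last v s = z ->
  exists t, [/\ path (adj H) u t, last u t = z &
    forall w, w \in us -> w \notin v :: s -> w \notin t].
Proof.
move=> zus vs sz; have [nuz uz] := imm_dominates (etrans (esym (usE z)) zus).
have [_ zG domuz] := iffLR (dominatesP wfG rootG u z) uz.
have : has (pred1 u) (v :: s) by rewrite has_pred1; apply: domuz.
case/split_last_has => s1 [u1 [s2 [sE /eqP u1E us2]]]; rewrite u1E {u1E} in sE.
rewrite has_pred1 in us2.
have [us2path s2z] := path_suffix vs sE; rewrite sz in s2z.
have s2dom y : y \in s2 -> dominates G v u y /\ u != y.
  move=> ys2; split; last by apply: contraNneq us2 => ->.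
  (* A path to [y] avoiding [u] could be continued along the rest of [s] to [z], which [u]
     dominates. *)
  case/splitPr: ys2 us2 us2path s2z {sE} => q1 q2.
  rewrite mem_cat inE !negb_or => /and3P[_ _ uq2].
  rewrite cat_path last_cat /= => /and3P[_ qy yq2] q2z.
  have [_ yG] := adj_verts wfG qy.
  apply/(dominatesP wfG rootG); split=> // q vq qlast.
  have := domuz (q ++ q2); rewrite cat_path vq last_cat qlast yq2 q2z.
  by move=> /(_ isT erefl); rewrite -cat_cons mem_cat (negbTE uq2) orbF.
have [t [ut tlast tsub]] :=
  quotient_path us2path (dominates_refl wfG rootG uG) s2dom.
rewrite proj_u in ut tlast; exists t; split=> //.
  by rewrite tlast s2z proj_imm.
(* If [w] is the projection of a vertex [y] of [s], then [w] dominates [y] and so lies on the prefix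
   of [s] up to [y]. *)
move=> w wus; apply: contra => /tsub/mapP[y ys2 wy].
have [uy nuy] := s2dom _ ys2; have [_ /domP] := projP uy nuy; rewrite -wy.
case/(dominatesP wfG rootG) => _ _ domwy.
have yvs : y \in v :: s by rewrite sE mem_cat inE ys2 !orbT.
have [p1 [p2 [-> vp1 p1y _]]] := path_split vs yvs.
by rewrite -cat_cons mem_cat domwy.
Qed.

(** If [w] dominated [z] in [G], it would dominate the immediate dominator [u] of [z]; so some path
    to [z] avoids [w], and its projection still does. *)
Lemma quotient_no_dom w z : w \in us -> z \in us -> w != z ->
  exists t, [/\ path (adj H) u t, last u t = z & w \notin t].
Proof.
move=> wus zus wz; have [_ uw] := imm_dominates (etrans (esym (usE w)) wus).
have [_ uz] := imm_dominates (etrans (esym (usE z)) zus).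
have [_ wG _] := iffLR (dominatesP wfG rootG u w) uw.
have [_ zG _] := iffLR (dominatesP wfG rootG u z) uz.
have [|s [vs sz ws]] := not_dominates wfG rootG wG zG.
  move=> wzd; have /immP[_ _ /(_ w wz wzd) wu] : z \in imm G v u by rewrite -usE.
  have := u_notin_us; rewrite (dominates_antisym wfG rootG uw wu).
  by rewrite wus.
by have [t [ut tz tw]] := quotient_path_to zus vs sz; exists t; split=> //; apply: tw.
Qed.

Lemma quotient_reach z : z \in us -> exists2 t, path (adj H) u t & last u t = z.
Proof.
move=> zus; have [_ uz] := imm_dominates (etrans (esym (usE z)) zus).
have [_ zG _] := iffLR (dominatesP wfG rootG u z) uz.
have [s vs sz] := path_from_root rootG zG.
by have [t [ut tz _]] := quotient_path_to zus vs sz; exists t.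
Qed.

End ContractedGraph.

(** * Components with an auxiliary root, and the theorem *)

Lemma hat_prime (V E : finType) (D : digraph V E) (u : V) (W : {set V}) :
    (forall e, e \in edges D -> tgt D e != u) ->
    (forall x, x \in W -> exists2 t, path (adj D) u t & last u t = x) ->
    (forall x y, x \in W -> y \in W -> x != u -> y != u -> x != y ->
      exists t, [/\ path (adj D) u t, last u t = y & x \notin t]) ->
  scc D W -> prime_poly (kappa (hat D W)).
Proof.
move=> no_in_u reach no_dom [WD [W0 scW] _].
have WE : verts D :&: W = W by apply/setIidPr.
have mem_verts x : x \in W -> x \in verts (induced D W) by rewrite /= WE.
have conW x y : x \in W -> y \in W -> connect (adj (induced D W)) x y.
  by move=> xW yW; apply: reachable_connect; apply: scW; apply: mem_verts.
(* No edge enters [u], so a component containing [u] is a single vertex. *)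
have only_u : u \in W -> forall x, x \in W -> x = u.
  move=> uW x xW; have /connectP[p] := conW x u xW uW.
  case/lastP: p => [_ -> //|p y]; rewrite rcons_path last_rcons => /andP[_ py] uy.
  case/adjP: py => e [/setIdP[eD _] _]; rewrite -uy => ty.
  by have := no_in_u _ eD; rewrite [tgt D e]ty eqxx.
rewrite /hat -[verts (induced D W)]/(verts D :&: W) WE; case: ifP => [iniW|/negbT niniW].
  (* Traced backwards, a path from [u] into an initial component never leaves it. *)
  have uW : u \in W.
    have [x xW] : exists x, x \in W by apply/set0Pn; rewrite -WE.
    have [t ut tx] := reach x xW; elim/last_ind: t x xW ut tx => [|t y IHt] x xW.
      by move=> _ /= ->.
    rewrite rcons_path last_rcons => /andP[ut uy] yx; apply: IHt ut erefl.
    case/adjP: uy => e [eD <- ty]; apply: (implyP (forall_inP iniW e eD)).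
    by rewrite ty yx.
  have noU x : x \in [set Some y | y in W] :\ Some u -> False.
    by case/setD1P => + /imsetP[y yW xE]; rewrite xE (only_u uW _ yW) eqxx.
  apply: (@kappa_prime _ _ _ (Some u)) => /=.
  - exact: imset_f.
  - by move=> e /setIdP[_ /andP[sW tW]]; rewrite !imset_f.
  - by move=> e /setIdP[eD _]; apply: contra (no_in_u _ eD) => /eqP[->].
  - by move=> _ /imsetP[x xW ->]; rewrite (only_u uW _ xW) connect0.
  - by move=> x y /noU.
  - by move=> x y /noU.
have uW : u \notin W.
  apply: contra niniW => uW; apply/forall_inP => e eD; apply/implyP => tW.
  by have := no_in_u _ eD; rewrite (only_u uW _ tW) eqxx.
set F := Digraph _ _ _ _.
have adjF x y : adj (induced D W) x y -> adj F (Some x) (Some y).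
  case/adjP => e [eD sx ty]; apply/adjP; exists e; rewrite /F /=.
  move: (eD); rewrite !inE => /and3P[-> sW tW].
  by split; rewrite ?sW ?tW //= ?[src D e]sx ?[tgt D e]ty.
have adjND x y : x \notin W -> y \in W -> adj D x y -> adj F None (Some y).
  move=> xW yW /adjP[e [eD sx ty]]; apply/adjP; exists e.
  by rewrite /F /= !inE sx ty eD xW yW /= orbT (negbTE xW).
(* The path is cut after its last vertex outside [W], and that vertex is replaced by [None]. This
   transfers both reachability and avoidance of a vertex to the hatted component. *)
have enter y t : y \in W -> path (adj D) u t -> last u t = y ->
    exists p, [/\ path (adj F) None p, last None p = Some y &
                  forall x, Some x \in p -> x \in t].
  move=> yW ut uty.
  have : has (predC (mem W)) (u :: t) by rewrite /= uW.
  case/split_last_has => s1 [z [s2 [sE /= zW s2W]]].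
  have [zs2 s2y] := path_suffix ut sE; rewrite uty in s2y.
  have {}s2W x : x \in s2 -> x \in W by move=> /(hasPn s2W) /=; rewrite negbK.
  have s2t x : x \in s2 -> x \in t.
    by case: s1 sE => [[_ ->]|_ s1 [_ ->]] // xs2; rewrite mem_cat inE xs2 !orbT.
  exists (map Some s2); split; last by move=> x /mapP[x' /s2t + [->]].
    case: s2 zs2 s2W {s2y s2t sE} => //= a s2 /andP[za as2] s2W.
    rewrite (adjND z a zW (s2W _ (mem_head _ _)) za) /=.
    elim: s2 a {za} as2 s2W => //= b s2 IHs2 a /andP[ab bs2] s2W.
    rewrite IHs2 // ?andbT; last by move=> x xs2; apply: s2W; rewrite inE xs2 orbT.
    apply: adjF; case/adjP: ab => e [eD sx ty]; apply/adjP; exists e; split=> //.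
    by rewrite !inE eD sx ty !s2W // !inE eqxx ?orbT.
  case: (s2) s2y => [/= zy|a s2' /= <-]; last by rewrite last_map.
  by rewrite zy yW in zW.
have FU x : x \in verts F :\ None -> exists2 y, y \in W & x = Some y.
  by case/setD1P => xN /setU1P[E1|/imsetP[y yW ->]]; [rewrite E1 in xN | exists y].
have neq_u x : x \in W -> x != u by apply: contraTneq => ->.
apply: (@kappa_prime _ _ _ None) => [|e|e|x|x y|x y].
- by rewrite !inE.
- rewrite /F /= !inE => /orP[/and3P[_ sW tW]|/and3P[_ sW tW]].
    by rewrite sW !imset_f // orbT.
  by rewrite (negbTE sW) eqxx imset_f // orbT.
- by [].
- case/setU1P => [->|/imsetP[y yW ->]]; first exact: connect0.
  have [t ut ty] := reach y yW; have [p [Np py _]] := enter y t yW ut ty.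
  by apply/connectP; exists p.
- move=> /FU[x' x'W ->] /FU[y' y'W ->].
  have /connectP[p xp ->] := conW _ _ x'W y'W.
  apply/connectP; exists (map Some p); last by rewrite last_map.
  by rewrite path_map; apply: sub_path xp => a b; apply: adjF.
move=> /FU[x' x'W ->] /FU[y' y'W ->] xy.
have [|t [ut ty x't]] := no_dom _ _ x'W y'W (neq_u _ x'W) (neq_u _ y'W).
  by apply: contra xy => /eqP->.
have [p [Np py psub]] := enter y' t y'W ut ty; exists p; split=> //.
by apply: contra x't => /psub.
Qed.

Theorem theorem4p4 (V E : finType) (G : digraph V E) (v u : V) (us : seq V)
    (W : {set V}) :
  wf_digraph G -> rooted G v -> u \in verts G ->
  uniq us -> us =i imm G v u ->
  let H := root_at u
             (induced (contract_seq G [seq (dom G v z, z) | z <- us])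
                      [set x in u :: us]) in
  scc H W -> prime_poly (kappa (hat H W)).
Proof.
move=> wfG rootG uG uniq_us usE H sccW; have [WH _ _] := sccW.
have W_us x : x \in W -> x = u \/ x \in us.
  by move=> /(subsetP WH); rewrite !inE => /andP[_ /predU1P].
apply: (@hat_prime _ _ H u) sccW.
- by move=> e /setIdP[].
- move=> x /W_us[->|xus]; first by exists [::].
  exact: (quotient_reach wfG rootG uG uniq_us usE xus).
move=> x y /W_us[->|xus] /W_us[->|yus]; rewrite ?eqxx // => _ _.
exact: (quotient_no_dom wfG rootG uG uniq_us usE xus yus).
Qed.
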